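(* Let $\mathcal F$ be a transversally oriented codimension-one foliation of a Randers space $(M^{m+1},F=\alpha+\beta)$ with $\beta(N)=0$ on $M$. Then on $T\mathcal F$ we have $$ c\,A^g=\bar A-c^{-2}(cN-\beta^\sharp)(c)\,I_m+c^{-1}(\overline{\mathrm{Def}}_{\beta^\sharp})^\top_{|T\mathcal F}+U_1^\flat\otimes\beta^\sharp+U_2\otimes\beta, $$ where $$ U_1=-\tfrac12c^{-2}\Big((cN-\beta^\sharp)(c)\,\beta^\sharp-2c^{-1}(\overline{\mathrm{Def}}_{\beta^\sharp}\beta^\sharp)^\top-\bar\nabla^\top_{N-c^{-1}\beta^\sharp}\beta^\sharp+c\bar Z+c\,\beta(\bar Z)\beta^\sharp-\bar A(\beta^\sharp)^{\bot\beta}\Big), $$ $$ U_2=\tfrac12\Big(\bar\nabla^\top_{N-c^{-1}\beta^\sharp}\beta^\sharp-c\bar Z-\bar A(\beta^\sharp)^{\bot\beta}\Big). $$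
   Context: $a=\langle\cdot,\cdot\rangle$ is a Riemannian metric on $M^{m+1}$ with Levi-Civita connection $\bar\nabla$, $\alpha(y)=\sqrt{\langle y,y\rangle}$, $\beta$ is a 1-form with $\|\beta\|_\alpha<1$, $F=\alpha+\beta$ the Randers metric; $\sharp,\flat$ are taken with respect to $a$. $N$ is the $a$-unit normal to $\mathcal F$ (so $\beta(N)=0$ means $\beta^\sharp\in\Gamma(T\mathcal F)$); $c=(1-\|\beta\|_\alpha^2)^{1/2}>0$ is a function on $M$ and $X(c)$ denotes its derivative along a vector field $X$. The $F$-unit normal to $\mathcal F$ is $\nu=c^{-2}(cN-\beta^\sharp)$. For $y\neq0$, $g_y(u,v)=\frac12\frac{\partial^2}{\partial s\partial t}[F^2(y+su+tv)]_{s=t=0}$; $g=g_\nu$ is a Riemannian metric with Levi-Civita connection $\nabla$. $\bar A(u)=-\bar\nabla_uN$ and $A^g(u)=-\nabla_u\nu$ for $u\in T\mathcal F$; $\bar Z=\bar\nabla_NN$; $^\top$ is the $a$-orthogonal projection onto $T\mathcal F$, $\bar\nabla^\top_Xu=(\bar\nabla_Xu)^\top$. $\overline{\mathrm{Def}}_u=\frac12(\bar\nabla u+(\bar\nabla u)^t)$, where $(\bar\nabla u)(v)=\bar\nabla_vu$ and $^t$ is the $a$-adjoint. For $\beta\ne0$, $\bar A(\beta^\sharp)^{\bot\beta}=\bar A(\beta^\sharp)-\langle\bar A(\beta^\sharp),\beta^\sharp\rangle\|\beta^\sharp\|_\alpha^{-2}\beta^\sharp$ (and it is $0$ where $\beta=0$).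 Tensor products: $(U^\flat\otimes\beta^\sharp)(u)=\langle U,u\rangle\beta^\sharp$, $(U\otimes\beta)(u)=\beta(u)U$. *)

(* Defs.v *)
From mathcomp Require Import all_boot all_order all_algebra.
From mathcomp Require Import all_classical all_reals all_analysis.
Import Order.TTheory GRing.Theory Num.Theory.
Import numFieldNormedType.Exports.

Set Implicit Arguments.
Unset Strict Implicit.
Unset Printing Implicit Defensive.

Local Open Scope classical_set_scope.
Local Open Scope ring_scope.

Section SmoothFunctionsOnCoordinateSpace.
Variables (R : realType) (n : nat).
Let E := 'rV[R]_n.+1.

(* Only meaningful for open U. *)
Fixpoint Ck_on (k : nat) (U : set E) (f : E -> R) : Prop :=
  {in U, continuous f} /\
  if k is k'.+1 then
    forall i : 'I_n.+1,
      (forall x, U x -> derivable f x (delta_mx 0 i)) /\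
      Ck_on k' U ('D_(delta_mx 0 i) f)
  else True.

Definition smooth_on (U : set E) (f : E -> R) : Prop :=
  forall k, Ck_on k U f.

End SmoothFunctionsOnCoordinateSpace.

Section Manifolds.
Variables (R : realType) (n : nat) (M : topologicalType).
Let E := 'rV[R]_n.+1.

(* cmap and cinv are total functions; only their restrictions to cdom and to
   cmap @` cdom are meaningful. *)
Record chart := Chart {
  cdom : set M;
  cmap : M -> E;
  cinv : E -> M }.

Definition is_chart (phi : chart) : Prop :=
  [/\ open (cdom phi), open (cmap phi @` cdom phi),
      (forall p, cdom phi p -> cinv phi (cmap phi p) = p),
      {in cdom phi, continuous (cmap phi)} &
      {in cmap phi @` cdom phi, continuous (cinv phi)}].

Definition smooth_transition (phi psi : chart) : Prop :=
  forall i : 'I_n.+1,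
    smooth_on (cmap phi @` (cdom phi `&` cdom psi))
      (fun x => cmap psi (cinv phi x) 0 i).

Record smooth_manifold := SmoothManifold {
  atlas : set chart;
  atlas_chart : forall phi, atlas phi -> is_chart phi;
  atlas_cover : forall p, exists2 phi, atlas phi & cdom phi p;
  atlas_transition : forall phi psi,
    atlas phi -> atlas psi -> smooth_transition phi psi;
  manifold_hausdorff : hausdorff_space M;
  manifold_second_countable : @second_countable M }.

Variable S : smooth_manifold.

(* Membership in the maximal atlas. *)
Definition smooth_chart (phi : chart) : Prop :=
  is_chart phi /\
  forall psi, atlas S psi ->
    smooth_transition phi psi /\ smooth_transition psi phi.

(* "f is of class C^oo on a neighbourhood of p". *)
Definition smooth_at (p : M) (f : M -> R) : Prop :=
  forall phi, atlas S phi -> cdom phi p ->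
    exists U : set E,
      [/\ open U, U (cmap phi p) & smooth_on U (f \o cinv phi)].

Definition smooth (f : M -> R) : Prop := forall p, smooth_at p f.

Definition tvec := (M -> R) -> R^o.

(* T_pM is the space of derivations, at p, of the algebra of germs at p of
   smooth functions.  A derivation is represented by a function of all
   f : M -> R that only depends on the germ of f at p and that is set to 0 when
   f is not smooth at p; with this normalization Leibniz equality of tangent
   vectors is equality of derivations, and the vector space structure of T_pM
   is the pointwise one. *)
Definition tangent (p : M) : set tvec := [set v |
  [/\ forall (k : R) (f g : M -> R), smooth_at p f -> smooth_at p g ->
        v (fun q => k * f q + g q) = k * v f + v g,
      forall f g : M -> R, smooth_at p f -> smooth_at p g ->
        v (fun q => f q * g q) = f p * v g + g p * v f,
      forall f g : M -> R, (\forall q \near p, f q = g q) -> v f = v g &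
      forall f : M -> R, ~ smooth_at p f -> v f = 0]].

Definition vfield (X : M -> tvec) : Prop :=
  (forall p, tangent p (X p)) /\
  (forall p f, smooth_at p f -> smooth_at p (fun q => X q f)).

(* Possibly degenerate or indefinite forms on the spaces T_pM. *)
Definition form2 := M -> tvec -> tvec -> R.

Definition riemannian (a : form2) : Prop :=
  [/\ forall p u v, tangent p u -> tangent p v -> a p u v = a p v u,
      forall p (k : R) u v w, tangent p u -> tangent p v -> tangent p w ->
        a p (k *: u + v) w = k * a p u w + a p v w,
      forall p u, tangent p u -> u != 0 -> 0 < a p u u &
      forall X Y, vfield X -> vfield Y -> smooth (fun p => a p (X p) (Y p))].

Definition one_form (b : M -> tvec -> R) : Prop :=
  (forall p (k : R) u v, tangent p u -> tangent p v ->
     b p (k *: u + v) = k * b p u + b p v) /\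
  (forall X, vfield X -> smooth (fun p => b p (X p))).

(* D X Y stands for the covariant derivative of Y along X. *)
Definition connection (D : (M -> tvec) -> (M -> tvec) -> M -> tvec) : Prop :=
  [/\ forall X Y, vfield X -> vfield Y -> vfield (D X Y),
      forall f X X' Y, smooth f -> vfield X -> vfield X' -> vfield Y ->
        forall p, D (fun q => f q *: X q + X' q) Y p
                  = f p *: D X Y p + D X' Y p,
      forall X Y Y', vfield X -> vfield Y -> vfield Y' ->
        forall p, D X (fun q => Y q + Y' q) p = D X Y p + D X Y' p &
      forall f X Y, smooth f -> vfield X -> vfield Y ->
        forall p, D X (fun q => f q *: Y q) p
                  = (X p f : R) *: Y p + f p *: D X Y p].

Definition levi_civita (g : form2)
    (D : (M -> tvec) -> (M -> tvec) -> M -> tvec) : Prop :=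
  [/\ connection D,
      forall X Y Z, vfield X -> vfield Y -> vfield Z ->
        forall p, X p (fun q => g q (Y q) (Z q))
                  = g p (D X Y p) (Z p) + g p (Y p) (D X Z p) &
      forall X Y, vfield X -> vfield Y ->
        forall p f, smooth_at p f ->
          D X Y p f - D Y X p f
          = X p (fun q => Y q f) - Y p (fun q => X q f)].

(* A codimension-one foliation, given by its tangent distribution: the
   manifold is covered by foliated charts (x_0, ..., x_n), whose plaques are
   the level sets of the last coordinate, so that the tangent space to the
   leaves is the kernel of d x_n on the whole domain of such a chart. *)
Record foliation1 := Foliation1 {
  ftan : M -> set tvec;
  ftan_charts : forall p, exists phi,
    [/\ smooth_chart phi, cdom phi p &
        forall q, cdom phi q ->
          ftan q = [set v | tangent q v /\
                            v (fun z => cmap phi z 0 ord_max) = 0]] }.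

Definition ftan_field (F : foliation1) (X : M -> tvec) : Prop :=
  vfield X /\ forall p, ftan F p (X p).

(* Such a global N exists iff F is transversally oriented; the choice of N is
   the choice of a transversal orientation. *)
Definition unit_normal (a : form2) (F : foliation1) (N : M -> tvec) : Prop :=
  [/\ vfield N, forall p, a p (N p) (N p) = 1 &
      forall p v, ftan F p v -> a p (N p) v = 0].

Definition sharp (a : form2) (b : M -> tvec -> R) (B : M -> tvec) : Prop :=
  vfield B /\ forall p u, tangent p u -> a p (B p) u = b p u.

(* Lt is the a-adjoint of the endomorphism L of the tangent bundle. *)
Definition adjoint (a : form2) (L Lt : (M -> tvec) -> M -> tvec) : Prop :=
  forall Y, vfield Y ->
    vfield (Lt Y) /\
    forall X, vfield X -> forall p, a p (L X p) (Y p) = a p (X p) (Lt Y p).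

Section Randers.
Variables (a : form2) (b : M -> tvec -> R).

Definition alpha (p : M) (y : tvec) : R := Num.sqrt (a p y y).

Definition form_norm (p : M) : R :=
  sup [set `|b p y| | y in [set y | tangent p y /\ alpha p y = 1]].

Definition randers (p : M) (y : tvec) : R := alpha p y + b p y.

Definition fundamental (p : M) (y u v : tvec) : R :=
  2^-1 * derive1 (fun s : R =>
    derive1 (fun t : R => randers p (y + s *: u + t *: v) ^+ 2) 0) 0.

Definition cR (p : M) : R := Num.sqrt (1 - form_norm p ^+ 2).

Variables (N B : M -> tvec).

(* When B is the a-dual of b and b N = 0, nu is the unit normal for the Randers
   norm F: F nu = 1, and g_nu (nu, v) = 0 for all v tangent to the leaves. *)
Definition nu : M -> tvec :=
  fun p => cR p ^- 2 *: (cR p *: N p - B p).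

Definition gnu : form2 := fun p => fundamental p (nu p).

(* With N the a-unit normal of a foliation, this is the a-orthogonal projection
   onto its tangent distribution. *)
Definition tproj (X : M -> tvec) : M -> tvec :=
  fun p => X p - a p (X p) (N p) *: N p.

Variable D : (M -> tvec) -> (M -> tvec) -> M -> tvec.

Definition weingarten (nrm u : M -> tvec) : M -> tvec := fun p => - D u nrm p.

Definition Zbar : M -> tvec := D N N.

(* The deformation tensor of B; DBt is meant to be the a-adjoint of
   v |-> D v B. *)
Variable DBt : (M -> tvec) -> M -> tvec.

Definition Def (v : M -> tvec) : M -> tvec :=
  fun p => 2^-1 *: (D v B p + DBt v p).

Definition weingartenB_perp : M -> tvec := fun p =>
  let w := weingarten N B p in
  if B p == 0 then 0 else w - (a p w (B p) / a p (B p) (B p)) *: B p.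

(* Tangent vectors are derivations: this is (cN - B)(c). *)
Definition dcR : M -> R := fun p => (cR p *: N p - B p) cR.

Definition DtopB : M -> tvec :=
  tproj (D (fun p => N p - (cR p)^-1 *: B p) B).

Definition U1 : M -> tvec := fun p =>
  - (2^-1 * cR p ^- 2) *:
    (dcR p *: B p
     - (2 * (cR p)^-1) *: tproj (Def B) p
     - DtopB p
     + cR p *: Zbar p
     + (cR p * b p (Zbar p)) *: B p
     - weingartenB_perp p).

Definition U2 : M -> tvec := fun p =>
  2^-1 *: (DtopB p - cR p *: Zbar p - weingartenB_perp p).

End Randers.
End Manifolds.

(* Main.v *)
(* At vectors y tangent to the leaves, the fundamental tensor g at the F-normal
   nu is g(x, y) = c^2 (<x, y> - beta(x) beta(y)) + c^3 <x, N> beta(y), and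
   g(nu, x) = c <x, N> for all x. Hence Koszul's formula and integrability give
   2 g(nabla_u nu, v) = nu(g(u, v)) - g([nu, u], v) - g([nu, v], u) for u and v
   tangent to the leaves, and the brackets can be computed with the Levi-Civita
   connection of a. Expanding nu = c^-1 N - c^-2 B, the derivatives u(c) and
   v(c) cancel, and the result is the pairing with v of the right-hand side,
   because <D_X B, B> = - c X(c). Both sides are tangent to the leaves, where g
   is nondegenerate by the Cauchy-Schwarz inequality. *)

Require Import Defs.
From mathcomp Require Import all_boot all_order all_algebra.
From mathcomp Require Import all_classical all_reals all_analysis.
From mathcomp Require Import ring lra.
Import Order.TTheory GRing.Theory Num.Theory.
Import numFieldNormedType.Exports.
Local Open Scope classical_set_scope.
Local Open Scope ring_scope.

Set Implicit Arguments.
Unset Strict Implicit.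
Unset Printing Implicit Defensive.

(** The correction terms reflect a symmetry. The operator A^g is self-adjoint for g, while Abar is
    so only for a: on the leaves g(Abar u, v) = c^2 (<Abar u, v> - <u, Abar B> beta(v)). The terms
    with [W], the part of Abar B orthogonal to B, add c^2/2 (<u, W> beta(v) - beta(u) <v, W>), which
    makes this expression symmetric; multiples of B cancel in that difference. The extra c^-2 of U1
    against U2 compensates g(B, v) = c^4 beta(v), compared with g(W, v) = c^2 <W, v>. Two obstacles
    shape the proof. [W] divides by <B, B> and need not be smooth where B vanishes, so the
    right-hand side is not a vector field a priori; the two sides are compared at one point, by
    extending their values there to smooth fields. And c is defined by a supremum, so it can be
    differentiated only once its closed form (1 - <B, B>)^(1/2) is known. *)

Lemma is_derive_comp (R : realType) (V : normedModType R) (f : V -> R)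
    (g : R -> R) (x v : V) (df dg : R) :
  is_derive x v f df -> is_derive (f x) 1 g dg ->
  is_derive x v (g \o f) (dg * df).
Proof.
move=> [fx <-] [gx <-].
(* Only the derivative of [f] along [v] is given, not a differential, so the chain rule is applied
   to the one-variable function [F]. *)
pose F h : R := f (h *: v + x).
have F0 : F 0 = f x by rewrite /F scale0r add0r.
have DE (W : normedModType R) (k : V -> W) :
    'D_v k x = derive1 (fun h : R => k (h *: v + x)) 0.
  rewrite derive1E /derive.
  set g1 := fun h => h^-1 *: _; set g2 := fun h => h^-1 *: _.
  suff -> : g1 = g2 by [].
  by apply/funext => h; rewrite /g1 /g2 /= addr0 scale0r add0r [_%:A]mulr1.
have dF : derivable F 0 1 by apply: (derivable1P f x v).1.
have dgF : derivable g (F 0) 1 by rewrite F0.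
split.
  apply/(derivable1P (g \o f) x v).2/derivable1_diffP.
  by apply: (@differentiable_comp _ _ _ _ F g); apply/derivable1_diffP.
by rewrite !DE (derive1_comp dF dgF) F0 derive1E.
Qed.

(** * Functions of class C^k on open sets of the coordinate space *)

Section CkOn.
Variables (R : realType) (n : nat).
Let E := 'rV[R]_n.+1.
Implicit Types (U : set E) (f g : E -> R).

Lemma Ck_on_continuous k U f : Ck_on k U f -> {in U, continuous f}.
Proof. by case: k => [|k] []. Qed.

Lemma eq_Ck_on k U f g : open U -> (forall x, U x -> f x = g x) ->
  Ck_on k U f -> Ck_on k U g.
Proof.
move=> oU; elim: k f g => [|k IH] f g fg [cf df].
all: have nfg x : U x -> {near x, f =1 g} by
  move=> Ux; apply: filterS (open_nbhs_nbhs (conj oU Ux)) => y; exact: fg.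
all: split=> [x Ux|//].
- have {}Ux : U x by rewrite inE in Ux.
  rewrite /continuous_at -fg//; apply: cvg_trans (cf x _); last by rewrite inE.
  exact: near_eq_cvg (nfg _ Ux).
- have {}Ux : U x by rewrite inE in Ux.
  rewrite /continuous_at -fg//; apply: cvg_trans (cf x _); last by rewrite inE.
  exact: near_eq_cvg (nfg _ Ux).
move=> i; have [dfi Cf] := df i; split=> [x Ux|].
  exact: near_eq_derivable (nfg _ Ux) (dfi _ Ux).
by apply: IH Cf => x Ux; apply: near_eq_derive; exact: nfg.
Qed.

Lemma sub_Ck_on k U U' f : U' `<=` U -> Ck_on k U f -> Ck_on k U' f.
Proof.
move=> sU; elim: k f => [|k IH] f /= [cf df]; split=> //.
- by move=> x; rewrite inE => /sU Ux; apply: cf; rewrite inE.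
- by move=> x; rewrite inE => /sU Ux; apply: cf; rewrite inE.
- by move=> i; have [dfi Cf] := df i; split; [move=> x /sU /dfi|exact: IH].
Qed.

(** [Ck_on] speaks of the total partial derivatives, whose values off [U] are uncontrolled; this
    criterion accepts closed forms [f'] that are valid on [U] only. *)
Lemma Ck_onS k U f (f' : 'I_n.+1 -> E -> R) : open U ->
  {in U, continuous f} ->
  (forall i x, U x -> is_derive x (delta_mx 0 i : E) f (f' i x)) ->
  (forall i, Ck_on k U (f' i)) -> Ck_on k.+1 U f.
Proof.
move=> oU cf df Cf; split=> // i; split.
  by move=> x Ux; have [] := df i x Ux.
by apply: eq_Ck_on (Cf i) => // x Ux; have [_ ->] := df i x Ux.
Qed.

Lemma Ck_on_is_derive k U f i x : Ck_on k.+1 U f -> U x ->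
  is_derive x (delta_mx 0 i : E) f ('D_(delta_mx 0 i) f x).
Proof. by case=> _ /(_ i)[df _] Ux; apply: derivableP; exact: df. Qed.

Lemma Ck_on_derive k U f i : Ck_on k.+1 U f ->
  Ck_on k U ('D_(delta_mx 0 i) f).
Proof. by case=> _ /(_ i)[]. Qed.

Lemma Ck_onW k U f : Ck_on k.+1 U f -> Ck_on k U f.
Proof.
elim: k f => [|k IH] f [cf df]; first by split.
by split=> // i; have [dfi Cf] := df i; split=> //; exact: IH.
Qed.

Lemma Ck_on_cst k U (r : R) : Ck_on k U (cst r).
Proof.
elim: k r => [|k IH] r; first by split=> // x _; exact: cst_continuous.
split=> [x _|i]; first exact: cst_continuous.
split=> [x _|]; first exact: derivable_cst.
suff -> : 'D_(delta_mx 0 i) (cst r : E -> R) = cst 0 by [].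
by apply/funext => x; rewrite derive_cst.
Qed.

Lemma Ck_onD k U f g : open U -> Ck_on k U f -> Ck_on k U g ->
  Ck_on k U (f + g).
Proof.
move=> oU; elim: k f g => [|k IH] f g Cf Cg.
  split=> // x Ux; apply: continuousD; first exact: (Ck_on_continuous Cf).
  exact: (Ck_on_continuous Cg).
apply: (Ck_onS (f' := fun i => 'D_(delta_mx 0 i) f + 'D_(delta_mx 0 i) g)) => //.
- move=> x Ux; apply: continuousD.
    exact: (Ck_on_continuous Cf).
  exact: (Ck_on_continuous Cg).
- move=> i x Ux; have df := Ck_on_is_derive i Cf Ux.
  by have dg := Ck_on_is_derive i Cg Ux; exact: is_deriveD.
- by move=> i; apply: IH; exact: Ck_on_derive.
Qed.

Lemma Ck_onM k U f g : open U -> Ck_on k U f -> Ck_on k U g ->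
  Ck_on k U (f * g).
Proof.
move=> oU; elim: k f g => [|k IH] f g Cf Cg.
  split=> // x Ux; apply: continuousM; first exact: (Ck_on_continuous Cf).
  exact: (Ck_on_continuous Cg).
apply: (Ck_onS (f' := fun i =>
  f * 'D_(delta_mx 0 i) g + g * 'D_(delta_mx 0 i) f)) => //.
- move=> x Ux; apply: continuousM.
    exact: (Ck_on_continuous Cf).
  exact: (Ck_on_continuous Cg).
- move=> i x Ux; have df := Ck_on_is_derive i Cf Ux.
  by have dg := Ck_on_is_derive i Cg Ux; exact: is_deriveM.
- by move=> i; apply: Ck_onD => //; apply: IH;
    solve [exact: Ck_onW | exact: Ck_on_derive].
Qed.

(** The partial derivatives of 1/f are products of powers of 1/f with those of f, so the induction
    hypothesis applies to 1/f itself, one order lower. The square root is handled in the same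
    way. *)
Lemma Ck_onV k U f : open U -> (forall x, U x -> f x != 0) ->
  Ck_on k U f -> Ck_on k U (fun x => (f x)^-1).
Proof.
move=> oU f0; elim: k => [|k IH] Cf.
  split=> // x Ux; apply: continuousV; last exact: (Ck_on_continuous Cf).
  by apply: f0; rewrite inE in Ux.
have Cfk := IH (Ck_onW Cf).
apply: (Ck_onS (f' := fun i =>
  cst (-1) * ((fun x => (f x)^-1) * (fun x => (f x)^-1)) *
  'D_(delta_mx 0 i) f)) => //.
- move=> x Ux; apply: continuousV; last exact: (Ck_on_continuous Cf).
  by apply: f0; rewrite inE in Ux.
- move=> i x Ux; have := Ck_on_is_derive i Cf Ux => -[df _].
  split; first by apply: derivableV => //; exact: f0.
  rewrite deriveV//; last exact: f0.
  by rewrite !fctE /= /GRing.scale /= -expr2 exprVn mulN1r.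
- move=> i; apply: Ck_onM => //; last exact: Ck_on_derive.
  by do 2?[apply: Ck_onM => //]; exact: Ck_on_cst.
Qed.

Lemma Ck_on_sqrt k U f : open U -> (forall x, U x -> 0 < f x) ->
  Ck_on k U f -> Ck_on k U (Num.sqrt \o f).
Proof.
move=> oU f0; elim: k => [|k IH] Cf.
  split=> // x Ux; apply: continuous_comp; first exact: (Ck_on_continuous Cf).
  exact: sqrt_continuous.
have Cfk := IH (Ck_onW Cf).
apply: (Ck_onS (f' := fun i =>
  (fun x => (((cst 2 : E -> R) * (Num.sqrt \o f)) x)^-1) *
  'D_(delta_mx 0 i) f)) => //.
- move=> x Ux; apply: continuous_comp; first exact: (Ck_on_continuous Cf).
  exact: sqrt_continuous.
- move=> i x Ux; have df := Ck_on_is_derive i Cf Ux.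
  exact: (is_derive_comp df (is_derive1_sqrt (f0 _ Ux))).
- move=> i; apply: Ck_onM => //; last exact: Ck_on_derive.
  apply: Ck_onV => // [x Ux|]; last by apply: Ck_onM => //; exact: Ck_on_cst.
  by rewrite fctE mulf_neq0// gt_eqF// sqrtr_gt0 f0.
Qed.

End CkOn.

(** * Smooth functions near a point of the manifold *)

Section SmoothAt.
Variables (R : realType) (n : nat) (M : topologicalType).
Variable S : smooth_manifold R n M.
Implicit Types (p : M) (f g : M -> R) (k : R).

Lemma smooth_at_cst p k : smooth_at S p (fun=> k).
Proof.
move=> phi _ _; exists setT; split=> //; first exact: openT.
by move=> j; exact: Ck_on_cst.
Qed.

Lemma smooth_at_op2 (op : R -> R -> R) p f g :
  (forall j (U : set 'rV[R]_n.+1) h h', open U -> Ck_on j U h ->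
     Ck_on j U h' -> Ck_on j U (fun x => op (h x) (h' x))) ->
  smooth_at S p f -> smooth_at S p g ->
  smooth_at S p (fun q => op (f q) (g q)).
Proof.
move=> Cop sf sg phi aphi dphi.
have [U [oU Up CU]] := sf _ aphi dphi.
have [V [oV Vp CV]] := sg _ aphi dphi.
exists (U `&` V); split=> //; first exact: openI.
move=> j; apply: (Cop j _ (f \o cinv phi) (g \o cinv phi)); first exact: openI.
  exact: sub_Ck_on (CU j).
exact: sub_Ck_on (CV j).
Qed.

Lemma smooth_atD p f g : smooth_at S p f -> smooth_at S p g ->
  smooth_at S p (fun q => f q + g q).
Proof. by apply: smooth_at_op2 => j U h h'; exact: Ck_onD. Qed.

Lemma smooth_atM p f g : smooth_at S p f -> smooth_at S p g ->
  smooth_at S p (fun q => f q * g q).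
Proof. by apply: smooth_at_op2 => j U h h'; exact: Ck_onM. Qed.

(** The inverse and the square root are used on positive reals only; positivity at [p] spreads by
    continuity to a smaller neighbourhood. *)
Lemma smooth_at_pos (op : R -> R) p f :
  (forall j (U : set 'rV[R]_n.+1) h, open U -> (forall x, U x -> 0 < h x) ->
     Ck_on j U h -> Ck_on j U (fun x => op (h x))) ->
  0 < f p -> smooth_at S p f -> smooth_at S p (fun q => op (f q)).
Proof.
move=> Cop f0 sf phi aphi dphi.
have [U [oU Up CU]] := sf _ aphi dphi.
pose V := U `&` (f \o cinv phi) @^-1` [set x | 0 < x].
have oV : open V.
  rewrite openE => x [Ux fx0]; apply: filterI.
    exact: open_nbhs_nbhs (conj oU Ux).
  have : {for x, continuous (f \o cinv phi)} by apply: (CU 0).1; rewrite inE.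
  by apply; apply: open_nbhs_nbhs; split=> //; exact: open_gt.
exists V; split=> //.
  by split=> //=; have [_ _ -> //] := atlas_chart aphi.
move=> j; apply: (Cop j V (f \o cinv phi)) => //; first by move=> x [].
by apply: sub_Ck_on (CU j) => x [].
Qed.

Lemma smooth_atV p f : 0 < f p -> smooth_at S p f ->
  smooth_at S p (fun q => (f q)^-1).
Proof.
apply: smooth_at_pos => j U h oU h0; apply: Ck_onV => // x /h0.
by move=> /gt_eqF ->.
Qed.

Lemma smooth_at_sqrt p f : 0 < f p -> smooth_at S p f ->
  smooth_at S p (fun q => Num.sqrt (f q)).
Proof. by apply: smooth_at_pos => j U h; exact: Ck_on_sqrt. Qed.

End SmoothAt.

(** * Tangent vectors as derivations, and vector fields *)

Section Tangent.
Variables (R : realType) (n : nat) (M : topologicalType).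
Variable S : smooth_manifold R n M.
Implicit Types (p : M) (f g : M -> R) (k : R) (u v w : tvec R M)
  (X Y : M -> tvec R M).

Lemma tangent_lin p k u v :
  tangent S p u -> tangent S p v -> tangent S p (k *: u + v).
Proof.
move=> [ul uM ug un] [vl vM vg vn]; split=> [r f g sf sg|f g sf sg|f g fg|f nf].
- by rewrite /= !fctE ul// vl// /GRing.scale /=; ring.
- by rewrite /= !fctE uM// vM// /GRing.scale /=; ring.
- by rewrite /= !fctE (ug _ _ fg) (vg _ _ fg).
- by rewrite /= !fctE un// vn// scaler0 addr0.
Qed.

Lemma tangent0 p : tangent S p 0.
Proof.
have z h : (0 : tvec R M) h = 0 by [].
by split=> [r f g _ _|f g _ _|f g _|f _]; rewrite !z ?mulr0 ?addr0.
Qed.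

Lemma tangentZ p k u : tangent S p u -> tangent S p (k *: u).
Proof. by move=> tu; rewrite -[_ *: _]addr0; exact: tangent_lin (tangent0 p). Qed.

Lemma tangentD p u v : tangent S p u -> tangent S p v -> tangent S p (u + v).
Proof. by move=> tu tv; rewrite -[u]scale1r; exact: tangent_lin. Qed.

Lemma tangentN p u : tangent S p u -> tangent S p (- u).
Proof. by rewrite -scaleN1r; exact: tangentZ. Qed.

Lemma derivation_cst p v k : tangent S p v -> v (fun=> k) = 0.
Proof.
move=> [vl vM _ _]; have s1 := @smooth_at_cst _ _ _ S p.
have v1 : v (fun=> 1) = 0.
  have := vM _ _ (s1 1) (s1 1).
  rewrite (_ : (fun=> 1 * 1) = fun=> 1); last by apply/funext => q; rewrite mulr1.
  by rewrite !mul1r => /esym/eqP; rewrite -subr_eq0 addrK => /eqP.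
(* The constant is decomposed as (k - 1) * 1 + 1 to fit the linearity axiom, which is stated for k f
   + g. *)
have := vl (k - 1) _ _ (s1 1) (s1 1).
rewrite (_ : (fun=> (k - 1) * 1 + 1) = fun=> k); last first.
  by apply/funext => q; rewrite mulr1 subrK.
by rewrite v1 mulr0 addr0.
Qed.

Lemma derivationM p v f g : tangent S p v -> smooth_at S p f ->
  smooth_at S p g -> v (fun q => f q * g q) = f p * v g + g p * v f.
Proof. by case=> _ + _ _; exact. Qed.

Lemma derivation_lin p v k f g : tangent S p v -> smooth_at S p f ->
  smooth_at S p g -> v (fun q => k * f q + g q) = k * v f + v g.
Proof. by case=> + _ _ _; exact. Qed.

Lemma derivationV p v f : tangent S p v -> smooth S f -> (forall q, 0 < f q) ->
  v (fun q => (f q)^-1) = - (f p ^- 2) * v f.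
Proof.
move=> tv sf f0; have fp := lt0r_neq0 (f0 p).
have := derivationM tv (sf p) (smooth_atV (f0 p) (sf p)).
rewrite (_ : (fun q => _) = fun=> 1); last first.
  by apply/funext => q; rewrite divff// lt0r_neq0.
rewrite (derivation_cst _ tv) => /(congr1 (fun x => (f p)^-1 * x)).
rewrite mulr0 mulrDr mulKf// => /esym/eqP; rewrite addr_eq0 => /eqP ->.
by field.
Qed.

Lemma vfield_lin f X Y : smooth S f -> vfield S X -> vfield S Y ->
  vfield S (fun q => f q *: X q + Y q).
Proof.
move=> sf [tX sX] [tY sY]; split=> [p|p h sh]; first exact: tangent_lin.
by apply: smooth_atD; [apply: smooth_atM; [exact: sf|exact: sX]|exact: sY].
Qed.

Lemma vfield0 : vfield S (fun=> 0).
Proof.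
split=> [p|p h sh]; first exact: tangent0.
exact: smooth_at_cst.
Qed.

Lemma vfieldZ f X : smooth S f -> vfield S X -> vfield S (fun q => f q *: X q).
Proof.
move=> sf vX.
rewrite (_ : (fun q => _) = fun q => f q *: X q + 0); last first.
  by apply/funext => q; rewrite addr0.
exact: vfield_lin vfield0.
Qed.

Lemma smooth_cst k : smooth S (fun=> k).
Proof. by move=> p; exact: smooth_at_cst. Qed.

(* Linear combinations may be extended with coefficients frozen at p, so that
   no smoothness of scalar functions is needed. *)
Definition extendable p v := exists2 X, vfield S X & X p = v.

Lemma extendable_field p X : vfield S X -> extendable p (X p).
Proof. by exists X. Qed.

Lemma extendable_lin p k u v :
  extendable p u -> extendable p v -> extendable p (k *: u + v).
Proof.
move=> [X vX <-] [Y vY <-]; exists (fun q => k *: X q + Y q) => //.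
exact: (vfield_lin (f := fun=> k) (@smooth_cst k)).
Qed.

Lemma extendable0 p : extendable p 0.
Proof. by exists (fun=> 0) => //; exact: vfield0. Qed.

Lemma extendableZ p k u : extendable p u -> extendable p (k *: u).
Proof.
move=> eu; rewrite -[_ *: _]addr0; exact: extendable_lin (extendable0 p).
Qed.

Lemma extendableD p u v : extendable p u -> extendable p v -> extendable p (u + v).
Proof. by move=> eu ev; rewrite -[u]scale1r; exact: extendable_lin. Qed.

Lemma extendableN p u : extendable p u -> extendable p (- u).
Proof. by rewrite -scaleN1r; exact: extendableZ. Qed.

End Tangent.

(** * The one-variable derivatives behind the fundamental tensor *)

Section FundamentalTensor.
Variable R : realType.
Implicit Types A P Q b : R.

Lemma is_derive_affine A P : is_derive (0 : R) 1 (fun t : R => A + t * P) P.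
Proof.
rewrite (_ : (fun t => _) = cst A + P \*: (id : R -> R)); last first.
  by apply/funext => t; congr (_ + _); exact: mulrC.
have dP := is_deriveZ P (is_derive_id (0 : R) 1).
have := is_deriveD (is_derive_cst A (0 : R) 1) dP.
by rewrite add0r [_ *: _]mulr1.
Qed.

Lemma is_derive_quadratic A P Q :
  is_derive (0 : R) 1 (fun t : R => A + t * P + t ^+ 2 * Q) P.
Proof.
rewrite (_ : (fun t => _) =
    (fun t => A + t * P) + (id : R -> R) * (fun t => 0 + t * Q)); last first.
  by apply/funext => t; rewrite expr2 -mulrA -[t * Q]add0r.
apply: is_derive_eq (is_deriveD (is_derive_affine A P)
  (is_deriveM (is_derive_id (0 : R) 1) (is_derive_affine 0 Q))) _.
by rewrite /GRing.scale /= !mul0r addr0 !mul0r !addr0.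
Qed.

Lemma is_derive_sqrt_quadratic A P Q : 0 < A ->
  is_derive (0 : R) 1 (fun t : R => Num.sqrt (A + t * P + t ^+ 2 * Q))
    (P / (2 * Num.sqrt A)).
Proof.
move=> A0; have /is_derive_comp dq := is_derive_quadratic A P Q.
rewrite mulrC; apply: dq.
by rewrite mul0r expr0n mul0r !addr0; exact: is_derive1_sqrt.
Qed.

(** This is the inner derivative of the fundamental tensor: [A], [2 * P], [Q] are the coefficients
    of <x + t v, x + t v>, and [b0], [b1] those of beta(x + t v). For x = y + s u its result is the
    function of [s] in [derive1_randers], with [C + s * K] = <y + s u, v>. *)
Lemma derive1_randers_sqr A P Q b0 b1 : 0 < A ->
  derive1 (fun t : R =>
    (Num.sqrt (A + t * (2 * P) + t ^+ 2 * Q) + (b0 + t * b1)) ^+ 2) 0 =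
  2 * (Num.sqrt A + b0) * (P / Num.sqrt A + b1).
Proof.
move=> A0; have s0 : Num.sqrt A != 0 by rewrite gt_eqF ?sqrtr_gt0.
have d1 := is_derive_sqrt_quadratic (2 * P) Q A0.
have d2 := is_derive_affine b0 b1.
rewrite derive1E.
have [_ e] := is_deriveX 2 (is_deriveD d1 d2); apply: etrans e _.
by rewrite /= !fctE /GRing.scale /= !mul0r expr0n /= !mul0r !addr0; field.
Qed.

Lemma derive1_randers A P Q b0 b1 C K c1 : 0 < A ->
  derive1 (fun s : R =>
    2 * (Num.sqrt (A + s * (2 * P) + s ^+ 2 * Q) + (b0 + s * b1)) *
    ((C + s * K) / Num.sqrt (A + s * (2 * P) + s ^+ 2 * Q) + c1)) 0 =
  2 * ((P / Num.sqrt A + b1) * (C / Num.sqrt A + c1) +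
       (Num.sqrt A + b0) * (K / Num.sqrt A - C * P / Num.sqrt A ^+ 3)).
Proof.
move=> A0; have s0 : Num.sqrt A != 0 by rewrite gt_eqF ?sqrtr_gt0.
have d1 := is_derive_sqrt_quadratic (2 * P) Q A0.
have d2 := is_derive_affine b0 b1.
have d3 := is_derive_affine C K.
have d4 : is_derive (0 : R) 1
    (fun s : R => (Num.sqrt (A + s * (2 * P) + s ^+ 2 * Q))^-1)
    (- (Num.sqrt A ^- 2) * (P / Num.sqrt A)).
  case: d1 => d1 e1.
  have n0 : Num.sqrt (A + 0 * (2 * P) + 0 ^+ 2 * Q) != 0.
    by rewrite !mul0r expr0n /= mul0r !addr0.
  split; first exact: derivableV.
  rewrite deriveV// e1 /GRing.scale /= !mul0r expr0n /= !mul0r !addr0.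
  by field.
rewrite derive1E.
have d5 k : is_derive (0 : R) 1 (cst k : R -> R) 0 by exact: is_derive_cst.
have [_ e] := is_deriveM (is_deriveM (d5 2) (is_deriveD d1 d2))
  (is_deriveD (is_deriveM d3 d4) (d5 c1)).
apply: etrans e _.
by rewrite /= !fctE /GRing.scale /= !mul0r expr0n /= !mul0r !addr0; field.
Qed.

End FundamentalTensor.

Create HintDb tangent.
#[global] Hint Resolve tangentD tangentZ tangentN tangent0 tangent_lin : tangent.

(** * Algebra of the metric, and the fundamental tensor of a Randers norm *)

Section Riemannian.
Variables (R : realType) (n : nat) (M : topologicalType).
Variables (S : smooth_manifold R n M) (a : form2 R M).
Hypothesis ha : riemannian S a.
Implicit Types (p : M) (k : R) (u v w y : tvec R M) (X Y : M -> tvec R M).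

Lemma metricC p u v : tangent S p u -> tangent S p v -> a p u v = a p v u.
Proof. by case: ha => + _ _ _; exact. Qed.

Lemma metricDl p u v w : tangent S p u -> tangent S p v -> tangent S p w ->
  a p (u + v) w = a p u w + a p v w.
Proof.
case: ha => _ al _ _ tu tv tw.
by have := al p 1 u v w tu tv tw; rewrite scale1r mul1r.
Qed.

Lemma metric0l p w : tangent S p w -> a p 0 w = 0.
Proof.
move=> tw; have := metricDl (tangent0 S p) (tangent0 S p) tw.
by rewrite addr0 => /eqP; rewrite -subr_eq0 opprD addNKr oppr_eq0 => /eqP.
Qed.

Lemma metricZl p k u w : tangent S p u -> tangent S p w ->
  a p (k *: u) w = k * a p u w.
Proof.
case: ha => _ al _ _ tu tw; have := al p k u 0 w tu (tangent0 S p) tw.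
by rewrite metric0l// !addr0.
Qed.

Lemma metricNl p u w : tangent S p u -> tangent S p w -> a p (- u) w = - a p u w.
Proof. by move=> tu tw; rewrite -scaleN1r metricZl// mulN1r. Qed.

Lemma metricDr p u v w : tangent S p u -> tangent S p v -> tangent S p w ->
  a p w (u + v) = a p w u + a p w v.
Proof.
move=> tu tv tw; rewrite metricC//; last exact: tangentD.
by rewrite metricDl// !(metricC tw).
Qed.

Lemma metric0r p w : tangent S p w -> a p w 0 = 0.
Proof.
by move=> tw; rewrite (metricC tw (tangent0 S p)) metric0l.
Qed.

Lemma metricZr p k u w : tangent S p u -> tangent S p w ->
  a p w (k *: u) = k * a p w u.
Proof.
move=> tu tw; rewrite metricC//; last exact: tangentZ.
by rewrite metricZl// (metricC tw).
Qed.

Lemma metricNr p u w : tangent S p u -> tangent S p w -> a p w (- u) = - a p w u.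
Proof. by move=> tu tw; rewrite -scaleN1r metricZr// mulN1r. Qed.

Lemma metric_gt0 p u : tangent S p u -> u != 0 -> 0 < a p u u.
Proof. by case: ha => _ _ + _; exact. Qed.

Lemma metric_ge0 p u : tangent S p u -> 0 <= a p u u.
Proof.
move=> tu; have [->|u0] := eqVneq u 0; first by rewrite metric0l//; exact: tangent0.
exact/ltW/metric_gt0.
Qed.

Lemma metric_smooth X Y : vfield S X -> vfield S Y ->
  smooth S (fun q => a q (X q) (Y q)).
Proof. by case: ha => _ _ _; exact. Qed.

Lemma metric_cauchy_schwarz p u v : tangent S p u -> tangent S p v ->
  a p u v ^+ 2 <= a p u u * a p v v.
Proof.
move=> tu tv; have [->|v0] := eqVneq v 0.
  by rewrite !metric0r// ?expr0n ?mulr0//; exact: tangent0.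
have vv0 := metric_gt0 tv v0.
have : 0 <= a p (a p v v *: u - a p u v *: v) (a p v v *: u - a p u v *: v).
  by apply: metric_ge0; auto with tangent.
rewrite metricDl ?metricDr ?metricNl ?metricNr ?metricZl ?metricZr;
  auto with tangent.
rewrite (metricC tv tu) => h.
have {h} : 0 <= a p v v * (a p u u * a p v v - a p u v ^+ 2).
  by apply: le_trans h _; rewrite le_eqVlt; apply/orP; left; apply/eqP; ring.
by rewrite pmulr_rge0// subr_ge0.
Qed.

Variable b : M -> tvec R M -> R.
Hypothesis hb : one_form S b.

Lemma oneformD p u v : tangent S p u -> tangent S p v ->
  b p (u + v) = b p u + b p v.
Proof.
case: hb => bl _ tu tv.
by have := bl p 1 u v tu tv; rewrite scale1r mul1r.
Qed.

Lemma oneform0 p : b p 0 = 0.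
Proof.
have := oneformD (tangent0 S p) (tangent0 S p).
by rewrite addr0 => /eqP; rewrite -subr_eq0 opprD addNKr oppr_eq0 => /eqP.
Qed.

Lemma oneformZ p k u : tangent S p u -> b p (k *: u) = k * b p u.
Proof.
case: hb => bl _ tu; have := bl p k u 0 tu (tangent0 S p).
by rewrite oneform0 !addr0.
Qed.

Lemma oneformN p u : tangent S p u -> b p (- u) = - b p u.
Proof. by move=> tu; rewrite -scaleN1r oneformZ// mulN1r. Qed.

(** The Hessian of F^2/2 is dF dF + F Hess F, and Hess F = Hess alpha because beta is linear on each
    tangent space. *)
Lemma fundamentalE p y u v : tangent S p y -> tangent S p u -> tangent S p v ->
  0 < a p y y -> let r := alpha a p y in
  fundamental a b p y u v =
    (a p y u / r + b p u) * (a p y v / r + b p v) +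
    (r + b p y) * (a p u v / r - a p y v * a p y u / r ^+ 3).
Proof.
move=> ty tu tv A0 /=; rewrite /fundamental.
pose A s := a p y y + s * (2 * a p y u) + s ^+ 2 * a p u u.
have AE s : a p (y + s *: u) (y + s *: u) = A s.
  rewrite metricDl ?metricDr ?metricZl ?metricZr; auto with tangent.
  by rewrite (metricC tu ty) /A; ring.
(* The square root is differentiated at positive arguments, so the inner derivative is put in closed
   form for [s] near 0 only; the outer derivative at 0 sees no more. *)
have As : \forall s \near (0 : R), 0 < A s.
  have [dA _] := is_derive_quadratic (a p y y) (2 * a p y u) (a p u u).
  move/derivable1_diffP/differentiable_continuous : dA => cA.
  apply: (cA [set x : R | 0 < x]); apply: open_nbhs_nbhs; split; first exact: open_gt.
  by rewrite /= !mul0r expr0n mul0r !addr0.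
rewrite [derive1 _ _]derive1E.
rewrite (@near_eq_derive _ _ _ _ (fun s : R =>
    2 * (Num.sqrt (A s) + (b p y + s * b p u)) *
    ((a p y v + s * a p u v) / Num.sqrt (A s) + b p v))); last first.
  apply: filterS As => s As.
  have := derive1_randers_sqr (a p y v + s * a p u v) (a p v v)
    (b p y + s * b p u) (b p v) As.
  apply: etrans; congr (derive1 _ 0); apply/funext => t.
  rewrite /randers /alpha !(metricDl, metricDr, metricZl, metricZr, AE,
    oneformD, oneformZ);
    auto with tangent.
  all: try solve [auto 10 with tangent].
  congr ((Num.sqrt _ + _) ^+ 2); rewrite /A.
  by rewrite (metricC tu ty) (metricC tv ty) (metricC tv tu); ring.
have s0 : alpha a p y != 0 by rewrite gt_eqF ?sqrtr_gt0.
rewrite -derive1E (derive1_randers _ _ _ _ _ _ _ A0) -/(alpha a p y).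
by field.
Qed.
End Riemannian.

(** * The function c, the normal nu and the fundamental tensor at nu *)

Section RandersNormal.
Variables (R : realType) (n : nat) (M : topologicalType).
Variables (S : smooth_manifold R n M) (a : form2 R M) (b : M -> tvec R M -> R).
Variables (N B : M -> tvec R M).
Hypotheses (ha : riemannian S a) (hb : one_form S b).
Hypotheses (vN : vfield S N) (aNN : forall p, a p (N p) (N p) = 1).
Hypotheses (bN : forall p, b p (N p) = 0) (hB : sharp S a b B).
Hypothesis hnorm : forall p, form_norm S a b p < 1.
Implicit Types (p : M) (k : R) (u v w y : tvec R M) (X Y : M -> tvec R M).

Let c := cR S a b.
Let V := nu S a b N B.
Let tN p : tangent S p (N p) := vN.1 p.
Let tB p : tangent S p (B p) := hB.1.1 p.

Let bE p u : tangent S p u -> b p u = a p (B p) u.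
Proof. by move=> tu; rewrite hB.2. Qed.

(** Cauchy-Schwarz bounds the supremum, and B/|B| attains the bound. Where B vanishes, the unit
    vector [N p] attains the value 0 instead; [N p] also shows that the set is nonempty. *)
Lemma form_normE p : form_norm S a b p = Num.sqrt (a p (B p) (B p)).
Proof.
apply/eqP; rewrite eq_le; apply/andP.
have ubB : ubound [set `|b p y| | y in [set y | tangent S p y /\ alpha a p y = 1]]
    (Num.sqrt (a p (B p) (B p))).
  move=> _ [y [ty y1] <-].
  have yy : a p y y = 1.
    by rewrite -[LHS]sqr_sqrtr ?(metric_ge0 ha)// -/(alpha a p y) y1 expr1n.
  rewrite bE// -sqrtr_sqr ler_wsqrtr//.
  by have := metric_cauchy_schwarz ha (tB p) ty; rewrite yy mulr1.
split.
  apply: ge_sup => //; exists `|b p (N p)|; exists (N p) => //.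
  by split=> //; rewrite /alpha aNN sqrtr1.
apply: ub_le_sup; first by exists (Num.sqrt (a p (B p) (B p))).
have [B0|B0] := eqVneq (B p) 0.
  exists (N p); first by split=> //; rewrite /alpha aNN sqrtr1.
  by rewrite bN normr0 B0 (metric0r ha) ?sqrtr0//; exact: tangent0.
have BB0 := metric_gt0 ha (tB p) B0.
have s0 : Num.sqrt (a p (B p) (B p)) != 0 by rewrite gt_eqF ?sqrtr_gt0.
have sE := sqr_sqrtr (ltW BB0).
exists ((Num.sqrt (a p (B p) (B p)))^-1 *: B p).
  split; first exact: tangentZ.
  rewrite /alpha (metricZl ha) ?(metricZr ha)//; last exact: tangentZ.
  by rewrite -[X in _ * (_ * X)]sE expr2 mulrA -mulrA mulKf// mulVf// sqrtr1.
rewrite (oneformZ hb)// bE// -[X in _ * X]sE expr2 mulKf//.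
by rewrite ger0_norm// sqrtr_ge0.
Qed.

Lemma cRE p : c p = Num.sqrt (1 - a p (B p) (B p)).
Proof. by rewrite /c /cR form_normE sqr_sqrtr// (metric_ge0 ha). Qed.

Let cR_arg_gt0 p : 0 < 1 - a p (B p) (B p).
Proof.
by rewrite subr_gt0 -ltr_sqrt// sqrtr1 -form_normE.
Qed.

Lemma cR_gt0 p : 0 < c p. Proof. by rewrite cRE sqrtr_gt0. Qed.

Lemma cR_sqr p : c p ^+ 2 = 1 - a p (B p) (B p).
Proof. by rewrite cRE sqr_sqrtr// ltW. Qed.

Lemma cR_smooth : smooth S c.
Proof.
rewrite (_ : c = fun q => Num.sqrt (1 - a q (B q) (B q))); last first.
  by apply/funext => q; exact: cRE.
move=> p; apply: smooth_at_sqrt => //.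
rewrite (_ : (fun q => _) = fun q => 1 + -1 * a q (B q) (B q)); last first.
  by apply/funext => q; rewrite mulN1r.
apply: smooth_atD; first exact: smooth_at_cst.
apply: smooth_atM; first exact: smooth_at_cst.
by have [vB _] := hB; exact: metric_smooth.
Qed.

Lemma cRV_smooth : smooth S (fun q => (c q)^-1).
Proof. by move=> p; apply: smooth_atV (cR_gt0 p) (cR_smooth (p := p)). Qed.

Lemma nuE : V = fun q => (c q)^-1 *: N q + (- (c q)^-1 * (c q)^-1) *: B q.
Proof.
apply/funext => q; have c0 := lt0r_neq0 (cR_gt0 q).
rewrite /V /nu -/c scalerBr scalerA -scaleNr; congr (_ *: _ + _ *: _).
  by field.
by field.
Qed.

Lemma nu_vfield : vfield S V.
Proof.
rewrite nuE; apply: vfield_lin; first exact: cRV_smooth.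
  exact: vN.
apply: vfieldZ; last by case: hB.
rewrite (_ : (fun q => _) = fun q => -1 * ((c q)^-1 * (c q)^-1)); last first.
  by apply/funext => q; ring.
move=> p; apply: smooth_atM; first exact: smooth_at_cst.
by apply: smooth_atM; exact: cRV_smooth.
Qed.

Let tV p : tangent S p (V p) := nu_vfield.1 p.

Lemma metric_nu p u : tangent S p u ->
  a p (V p) u = (c p)^-1 * a p (N p) u - (c p) ^- 2 * b p u.
Proof.
move=> tu; have c0 := lt0r_neq0 (cR_gt0 p); rewrite bE// nuE.
rewrite (metricDl ha) ?(metricZl ha); auto with tangent.
by field.
Qed.

Lemma oneform_nu p : b p (V p) = 1 - c p ^- 2.
Proof.
have c0 := lt0r_neq0 (cR_gt0 p).
rewrite nuE (oneformD hb) ?(oneformZ hb); auto with tangent.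
rewrite bN bE// (_ : a p (B p) (B p) = 1 - c p ^+ 2); last by rewrite cR_sqr; ring.
by field.
Qed.

Lemma alpha_nu p : alpha a p (V p) = c p ^- 2.
Proof.
have c0 := lt0r_neq0 (cR_gt0 p).
rewrite /alpha metric_nu// oneform_nu (metricC ha)// metric_nu// aNN bN.
rewrite -[RHS]ger0_norm ?invr_ge0 ?exprn_ge0 ?ltW ?cR_gt0//.
by rewrite -sqrtr_sqr; congr Num.sqrt; field.
Qed.

(** Here alpha(nu) = c^-2 and beta(nu) = 1 - c^-2, so F(nu) = 1, and c <N, x> - beta(x) is the
    differential of alpha at nu applied to x. *)
Lemma gnuE p u v : tangent S p u -> tangent S p v ->
  gnu S a b N B p u v =
    c p ^+ 2 * a p u v + b p u * b p v +
    (c p * a p (N p) u - b p u) * b p v + (c p * a p (N p) v - b p v) * b p u +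
    (1 - c p ^+ 2) * (c p * a p (N p) u - b p u) * (c p * a p (N p) v - b p v).
Proof.
move=> tu tv; have c0 := lt0r_neq0 (cR_gt0 p).
have aV : 0 < a p (V p) (V p).
  rewrite -sqrtr_gt0 -/(alpha a p (V p)) alpha_nu invr_gt0.
  by rewrite exprn_gt0// cR_gt0.
rewrite /gnu (fundamentalE ha hb (tV p) tu tv aV) alpha_nu oneform_nu.
by rewrite !metric_nu//; field.
Qed.

Lemma gnu_nu p u : tangent S p u ->
  gnu S a b N B p (V p) u = c p * a p (N p) u.
Proof.
move=> tu; have c0 := lt0r_neq0 (cR_gt0 p).
rewrite gnuE// metric_nu// oneform_nu (metricC ha (tN p) (tV p)) metric_nu//.
by rewrite aNN bN; field.
Qed.

End RandersNormal.

(** * Linearity of connections, and brackets *)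

Section Connections.
Variables (R : realType) (n : nat) (M : topologicalType).
Variable S : smooth_manifold R n M.
Implicit Types (p : M) (f g : M -> R) (X Y Z : M -> tvec R M)
  (D : (M -> tvec R M) -> (M -> tvec R M) -> M -> tvec R M).

Lemma connection_linl D f g X Y Z p : connection S D ->
  smooth S f -> smooth S g -> vfield S X -> vfield S Y -> vfield S Z ->
  D (fun q => f q *: X q + g q *: Y q) Z p = f p *: D X Z p + g p *: D Y Z p.
Proof.
move=> [_ Dl _ _] sf sg vX vY vZ.
have v0 := vfield0 S.
have D0 : D (fun=> 0) Z p = 0.
  have := Dl (fun=> 1) _ _ _ (@smooth_cst _ _ _ S 1) v0 v0 vZ p.
  rewrite (_ : (fun=> _) = fun=> 0); last first.
    by apply/funext => q; rewrite scale1r addr0.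
  by rewrite scale1r => /eqP; rewrite -subr_eq0 opprD addNKr oppr_eq0 => /eqP.
rewrite Dl//; last exact: vfieldZ.
congr (_ + _); have := Dl g _ _ _ sg vY v0 vZ p.
rewrite (_ : (fun q => _) = fun q => g q *: Y q); last first.
  by apply/funext => q; rewrite addr0.
by rewrite D0 addr0.
Qed.

Lemma connection_linr D f g X Y Z p : connection S D ->
  smooth S f -> smooth S g -> vfield S X -> vfield S Y -> vfield S Z ->
  D X (fun q => f q *: Y q + g q *: Z q) p =
    ((X p f : R) *: Y p + f p *: D X Y p) + ((X p g : R) *: Z p + g p *: D X Z p).
Proof.
move=> [_ _ Da Dz] sf sg vX vY vZ; rewrite -!Dz//.
by apply: Da => //; exact: vfieldZ.
Qed.

(** Both sides are the bracket [X, Y]: torsion-freeness gives this on functions smooth at [p], and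
    on all others tangent vectors are 0 by normalization. *)
Lemma levi_civita_bracket (g g' : form2 R M) D D' X Y p :
  levi_civita S g D -> levi_civita S g' D' -> vfield S X -> vfield S Y ->
  D X Y p - D Y X p = D' X Y p - D' Y X p.
Proof.
move=> [[vD _ _ _] _ tD] [[vD' _ _ _] _ tD'] vX vY.
apply/funext => f; have [sf|nf] := pselect (smooth_at S p f).
  exact: etrans (tD _ _ vX vY _ _ sf) (esym (tD' _ _ vX vY _ _ sf)).
have z Z : vfield S Z -> Z p f = 0 by case=> /(_ p)[_ _ _ + _]; exact.
have zD T : (forall X Y, vfield S X -> vfield S Y -> vfield S (T X Y)) ->
    (T X Y p - T Y X p) f = 0.
  by move=> vT; rewrite /= !fctE !z ?subrr//; exact: vT.
by rewrite !zD.
Qed.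

End Connections.

(** * Leaves as orthogonal complements of N, and integrability *)

Section Foliation.
Variables (R : realType) (n : nat) (M : topologicalType).
Variables (S : smooth_manifold R n M) (a : form2 R M) (F : foliation1 S).
Variable N : M -> tvec R M.
Hypotheses (ha : riemannian S a) (hN : unit_normal a F N).
Implicit Types (p : M) (u v X : M -> tvec R M).

(** For the converse, N does not annihilate the last foliated coordinate, since otherwise N would be
    tangent to the leaf and orthogonal to itself. So a multiple of N moves [v] into the leaf
    direction, and orthogonality to N forces that multiple to be 0. *)
Lemma ftanP p (v : tvec R M) :
  ftan F p v <-> tangent S p v /\ a p (N p) v = 0.
Proof.
have [[tN _] aNN aN] := hN; have [phi [_ dp Fp]] := ftan_charts F p.
split=> [Fv|[tv Nv]]; first by split; [move: Fv; rewrite Fp// => -[]|exact: aN].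
pose x z := cmap phi z 0 ord_max.
have Nx : N p x != 0.
  apply/eqP => Nx; have : ftan F p (N p) by rewrite Fp.
  by move/aN; rewrite aNN => /eqP; rewrite oner_eq0.
have FvN : ftan F p (v - (v x / N p x) *: N p).
  rewrite Fp//; split; first by auto with tangent.
  by rewrite /= !fctE /GRing.scale /= divfK// subrr.
have := aN _ _ FvN; rewrite (metricDr ha) ?(metricNr ha) ?(metricZr ha);
  auto with tangent.
rewrite Nv aNN mulr1 add0r => /eqP; rewrite oppr_eq0 => /eqP k0.
by move: FvN; rewrite k0 scale0r subr0.
Qed.

Lemma ftan_field_tproj X : vfield S X -> ftan_field F (tproj a N X).
Proof.
move=> vX; have [vN aNN _] := hN; split.
  rewrite (_ : tproj a N X = fun q => - a q (X q) (N q) *: N q + X q).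
    apply: vfield_lin => //.
    rewrite (_ : (fun q => _) = fun q => -1 * a q (X q) (N q)).
      move=> p; apply: smooth_atM; first exact: smooth_at_cst.
      exact: (metric_smooth ha).
    by apply/funext => q; rewrite mulN1r.
  by apply/funext => q; rewrite scaleNr addrC.
move=> p; have [tX tN] := (vX.1 p, vN.1 p).
apply/ftanP; split; first by rewrite /tproj; auto with tangent.
rewrite /tproj (metricDr ha) ?(metricNr ha) ?(metricZr ha); auto with tangent.
by rewrite aNN mulr1 (metricC ha)// subrr.
Qed.

(** The fields u and v annihilate the last foliated coordinate on a whole neighbourhood of [p], and
    derivations depend on germs only. *)
Lemma ftan_bracket (g : form2 R M) D u v p : levi_civita S g D ->
  ftan_field F u -> ftan_field F v -> ftan F p (D u v p - D v u p).
Proof.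
move=> [[vD _ _ _] _ tD] [vu Fu] [vv Fv].
have [phi [[cphi _] dp Fp]] := ftan_charts F p.
have tw : tangent S p (D u v p - D v u p).
  by have [[t1 _] [t2 _]] := (vD _ _ vu vv, vD _ _ vv vu); auto with tangent.
rewrite Fp//; split=> //=; set x := fun z => _.
have [sx|nx] := pselect (smooth_at S p x); last by case: tw => _ _ _; exact.
rewrite !fctE; apply: etrans (tD _ _ vu vv p x sx) _.
have z (u' v' : M -> tvec R M) : vfield S u' -> (forall q, ftan F q (v' q)) ->
    u' p (fun q => v' q x) = 0.
  move=> [tu' _] Fv'; rewrite -(derivation_cst 0 (tu' p)).
  have [_ _ + _] := tu' p; apply.
  have [oc _ _ _ _] := cphi.
  apply: filterS (open_nbhs_nbhs (conj oc dp)) => q dq.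
  by have := Fv' q; rewrite Fp// => -[].
by rewrite !z// subrr.
Qed.

End Foliation.

(** * The covariant derivative of nu paired with leaf fields *)

Section ShapeOperator.
Variables (R : realType) (n : nat) (M : topologicalType).
Variables (S : smooth_manifold R n M) (a : form2 R M) (b : M -> tvec R M -> R).
Variables (F : foliation1 S) (N B : M -> tvec R M).
Variables Dbar D : (M -> tvec R M) -> (M -> tvec R M) -> M -> tvec R M.
Hypotheses (ha : riemannian S a) (hb : one_form S b).
Hypotheses (hN : unit_normal a F N) (bN : forall p, b p (N p) = 0).
Hypotheses (hB : sharp S a b B) (hDbar : levi_civita S a Dbar).

(** These stand for [cR], [nu] and [gnu]. The computation sees them only through the identities
    below, never through the supremum and the iterated derivatives that define them. *)
Variables (c : M -> R) (V : M -> tvec R M) (G : form2 R M).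
Hypotheses (c_gt0 : forall p, 0 < c p) (sc : smooth S c).
Hypothesis c_sqr : forall p, c p ^+ 2 = 1 - a p (B p) (B p).
Hypotheses (vV : vfield S V)
  (nuE' : V = fun q => (c q)^-1 *: N q + (- (c q)^-1 * (c q)^-1) *: B q).
Hypothesis GE : forall p (x y : tvec R M), tangent S p x -> tangent S p y ->
  G p x y =
    c p ^+ 2 * a p x y + b p x * b p y +
    (c p * a p (N p) x - b p x) * b p y + (c p * a p (N p) y - b p y) * b p x +
    (1 - c p ^+ 2) * (c p * a p (N p) x - b p x) * (c p * a p (N p) y - b p y).
Hypothesis GV : forall p (x : tvec R M), tangent S p x ->
  G p (V p) x = c p * a p (N p) x.
Hypothesis hD : levi_civita S G D.
Implicit Types (p : M) (u v w X Y : M -> tvec R M).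

Let vN : vfield S N. Proof. by case: hN. Qed.
Let aNN p : a p (N p) (N p) = 1. Proof. by case: hN. Qed.
Let tN p : tangent S p (N p). Proof. exact: vN.1. Qed.
Let vB : vfield S B. Proof. by case: hB. Qed.
Let tB p : tangent S p (B p). Proof. exact: vB.1. Qed.
Let scV : smooth S (fun q => (c q)^-1).
Proof. by move=> p; exact: smooth_atV (c_gt0 p) (sc (p := p)). Qed.
Let tV p : tangent S p (V p). Proof. exact: vV.1. Qed.
Let bE p (x : tvec R M) : tangent S p x -> b p x = a p (B p) x.
Proof. by move=> tx; rewrite hB.2. Qed.
Let vDbar X Y : vfield S X -> vfield S Y -> vfield S (Dbar X Y).
Proof. by case: hDbar => -[+ _ _ _] _ _; exact. Qed.
Let vD X Y : vfield S X -> vfield S Y -> vfield S (D X Y).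
Proof. by case: hD => -[+ _ _ _] _ _; exact. Qed.
Let tDbar X Y p : vfield S X -> vfield S Y -> tangent S p (Dbar X Y p).
Proof. by move=> vX vY; exact: (vDbar vX vY).1. Qed.
Let tD X Y p : vfield S X -> vfield S Y -> tangent S p (D X Y p).
Proof. by move=> vX vY; exact: (vD vX vY).1. Qed.
#[local] Hint Resolve tN tB tV tDbar vDbar : tangent.

Let GC p (x y : tvec R M) : tangent S p x -> tangent S p y -> G p x y = G p y x.
Proof. by move=> tx ty; rewrite !GE// (metricC ha tx ty); ring. Qed.

Let GDl p (x y z : tvec R M) : tangent S p x -> tangent S p y -> tangent S p z ->
  G p (x + y) z = G p x z + G p y z.
Proof.
move=> tx ty tz; rewrite !GE//; last exact: tangentD.
by rewrite (oneformD hb)// (metricDl ha)// (metricDr ha)//; ring.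
Qed.

Let G_leaf p (x y : tvec R M) : tangent S p x -> tangent S p y ->
  a p (N p) y = 0 ->
  G p x y = c p ^+ 2 * (a p x y - b p x * b p y) + c p ^+ 3 * a p (N p) x * b p y.
Proof. by move=> tx ty Ny; rewrite GE// Ny; ring. Qed.

Let metric_compat X Y Z p : vfield S X -> vfield S Y -> vfield S Z ->
  X p (fun q => a q (Y q) (Z q)) = a p (Dbar X Y p) (Z p) + a p (Y p) (Dbar X Z p).
Proof. by move=> vX vY vZ; case: hDbar => _ + _; exact. Qed.

Let leaf w : ftan_field F w ->
  [/\ vfield S w, forall p, tangent S p (w p) & forall p, a p (N p) (w p) = 0].
Proof.
move=> [vw Fw]; split=> // p; first exact: vw.1.
by have [_] := (ftanP ha hN p (w p)).1 (Fw p).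
Qed.

Lemma koszul_nu u v p : ftan_field F u -> ftan_field F v ->
  2 * G p (D u V p) (v p) =
    V p (fun q => G q (u q) (v q)) - G p (Dbar V u p - Dbar u V p) (v p)
    - G p (Dbar V v p - Dbar v V p) (u p).
Proof.
move=> Fu Fv; have [vu tu Nu] := leaf Fu; have [vv tv Nv] := leaf Fv.
have G0 w : ftan_field F w -> (fun q => G q (V q) (w q)) = fun=> 0.
  by case/leaf => _ tw Nw; apply/funext => q; rewrite GV// Nw mulr0.
have [_ cD _] := hD.
have := cD _ _ _ vV vu vv p=> ->.
have := cD _ _ _ vu vV vv p ; rewrite G0// (derivation_cst _ (tu p)) => e2.
have := cD _ _ _ vv vV vu p ; rewrite G0// (derivation_cst _ (tv p)) => e3.
(* By integrability [u, v] has no N-component; with [e2] and [e3] this makes G(D_u V, v) symmetric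
   in u and v. *)
have e4 : a p (N p) (D u v p) = a p (N p) (D v u p).
  have := (ftanP ha hN p _).1 (ftan_bracket p hD Fu Fv) => -[_].
  rewrite (metricDr ha) ?(metricNr ha); auto with tangent.
  by move/eqP; rewrite subr_eq0 => /eqP.
have DE w : ftan_field F w -> D V w p = D w V p + (Dbar V w p - Dbar w V p).
  case=> vw _; rewrite (levi_civita_bracket p hDbar hD)//.
  by rewrite addrC subrK.
rewrite (DE u)// (DE v)// (GC (tu p)); auto with tangent.
rewrite !GDl; auto with tangent.
move: e2 e3; rewrite !GV ?e4; auto with tangent.
by move=> e2 e3; lra.
Qed.

(** The tangential parts of Dbar_V u and Dbar_V v cancel between the derivative of G(u, v) and the
    brackets. Their N-components survive, because G(x, v) contains c^3 <x, N> beta(v) when x is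
    transverse to the leaves. *)
Lemma gnu_D_nu u v p : ftan_field F u -> ftan_field F v ->
  2 * G p (D u V p) (v p) =
    2 * c p * V p c * (a p (u p) (v p) - b p (u p) * b p (v p))
    - c p ^+ 2 * (a p (u p) (Dbar V B p) * b p (v p)
                  + a p (v p) (Dbar V B p) * b p (u p))
    + c p ^+ 2 * (a p (v p) (Dbar u V p) + a p (u p) (Dbar v V p))
    - c p ^+ 2 * (a p (B p) (Dbar u V p) * b p (v p)
                  + a p (B p) (Dbar v V p) * b p (u p))
    - c p ^+ 3 * ((a p (N p) (Dbar V u p) - a p (N p) (Dbar u V p)) * b p (v p)
                  + (a p (N p) (Dbar V v p) - a p (N p) (Dbar v V p)) * b p (u p)).
Proof.
move=> Fu Fv; have [vu tu Nu] := leaf Fu; have [vv tv Nv] := leaf Fv.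
rewrite koszul_nu//.
have -> : (fun q => G q (u q) (v q)) = fun q => (c q * c q) *
    (-1 * (a q (B q) (u q) * a q (B q) (v q)) + a q (u q) (v q)).
  by apply/funext => q; rewrite G_leaf// Nu -!bE//; ring.
have sm X Y : vfield S X -> vfield S Y -> smooth_at S p (fun q => a q (X q) (Y q)).
  by move=> vX vY; exact: (metric_smooth ha).
have sBB := smooth_atM (sm _ _ vB vu) (sm _ _ vB vv).
have sm1 := @smooth_at_cst _ _ _ S p (-1).
rewrite (derivationM (tV p) (smooth_atM (sc (p := p)) (sc (p := p)))
  (smooth_atD (smooth_atM sm1 sBB) (sm _ _ vu vv))).
rewrite (derivationM (tV p) (sc (p := p)) (sc (p := p))).
rewrite (derivation_lin _ (tV p) sBB (sm _ _ vu vv)).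
rewrite (derivationM (tV p) (sm _ _ vB vu) (sm _ _ vB vv)).
rewrite !metric_compat// !G_leaf; auto with tangent.
rewrite !(metricDl ha) ?(metricNl ha) ?(metricDr ha) ?(metricNr ha)
  ?(oneformD hb) ?(oneformN hb); auto with tangent.
rewrite !bE; auto with tangent.
rewrite !(metricC ha (tDbar p _ _) (tu p))// !(metricC ha (tDbar p _ _) (tv p))//.
by ring.
Qed.

Lemma D_nu_l X p (x : tvec R M) : vfield S X -> tangent S p x ->
  a p x (Dbar V X p) =
    (c p)^-1 * a p x (Dbar N X p) - (c p) ^- 2 * a p x (Dbar B X p).
Proof.
move=> vX tx; have [cD _ _] := hDbar.
have c0 := lt0r_neq0 (c_gt0 p).
have sV2 : smooth S (fun q => - (c q)^-1 * (c q)^-1).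
  rewrite (_ : (fun q => _) = fun q => -1 * ((c q)^-1 * (c q)^-1)).
    move=> q; apply: smooth_atM; first exact: smooth_at_cst.
    by apply: smooth_atM; exact: scV.
  by apply/funext => q; ring.
rewrite nuE' (connection_linl p cD scV sV2 vN vB vX).
by rewrite (metricDr ha) ?(metricZr ha); auto with tangent; field.
Qed.

Lemma D_nu_r X p (x : tvec R M) : vfield S X -> tangent S p x ->
  a p x (Dbar X V p) =
    - (c p) ^- 2 * X p c * a p x (N p) + (c p)^-1 * a p x (Dbar X N p)
    + 2 * (c p) ^- 3 * X p c * a p x (B p) - (c p) ^- 2 * a p x (Dbar X B p).
Proof.
move=> vX tx; have [cD _ _] := hDbar.
have c0 := lt0r_neq0 (c_gt0 p); have tX := vX.1 p.
have sNV : smooth S (fun q => -1 * (c q)^-1).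
  by move=> q; apply: smooth_atM; [exact: smooth_at_cst|exact: scV].
have sV2 : smooth S (fun q => (-1 * (c q)^-1) * (c q)^-1).
  by move=> q; apply: smooth_atM; [exact: sNV|exact: scV].
have -> : V = fun q => (c q)^-1 *: N q + ((-1 * (c q)^-1) * (c q)^-1) *: B q.
  by rewrite nuE'; apply/funext => q; rewrite mulN1r.
rewrite (connection_linr p cD scV sV2 vX vN vB).
rewrite (derivationM tX (@sNV p) (@scV p)).
rewrite (derivationM tX (@smooth_at_cst _ _ _ S p (-1)) (@scV p)).
rewrite (derivation_cst _ tX) (derivationV tX sc c_gt0).
by rewrite !(metricDr ha) ?(metricZr ha); auto 10 with tangent; field.
Qed.

(** Since G(V, V) = 1, the derivative of V is G-orthogonal to V, and G(V, x) = c <N, x> makes this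
    the same as being a-orthogonal to N. *)
Lemma D_nu_tangent u p : ftan_field F u -> a p (N p) (D u V p) = 0.
Proof.
case=> vu _; have c0 := lt0r_neq0 (c_gt0 p).
have [_ cD _] := hD; have := cD _ _ _ vu vV vV p.
have -> : (fun q => G q (V q) (V q)) = fun=> 1.
  apply/funext => q; have cq := lt0r_neq0 (c_gt0 q).
  rewrite GV// nuE' (metricDr ha) ?(metricZr ha); auto with tangent.
  by rewrite aNN (metricC ha (tN q))// -bE// bN; field.
rewrite (derivation_cst _ (vu.1 p)) (GC (tD p vu vV) (tV p)) (GV (tD p vu vV)).
move/eqP; rewrite eq_sym -mulr2n mulrn_eq0 /= mulf_eq0 (negPf c0) /=.
by move/eqP.
Qed.

(** * The right-hand side: its symmetries, extension and pairings *)

Variable DBt : (M -> tvec R M) -> M -> tvec R M.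
Hypothesis hDBt : adjoint S a (fun v => Dbar v B) DBt.

Let Fleaf X : vfield S X -> (forall p, a p (N p) (X p) = 0) -> ftan_field F X.
Proof.
by move=> vX NX; split=> // q; apply/(ftanP ha hN); split=> //; exact: vX.1.
Qed.

Let Bleaf : ftan_field F B.
Proof. by apply: Fleaf => // q; rewrite (metricC ha)// -bE. Qed.

Let vDBt X : vfield S X -> vfield S (DBt X). Proof. by case/hDBt. Qed.

Let tDBt X p : vfield S X -> tangent S p (DBt X p).
Proof. by move=> vX; exact: (vDBt vX).1. Qed.

#[local] Hint Resolve tDBt vDBt : tangent.

Lemma metric_Def u w p : vfield S u -> vfield S w ->
  a p (w p) (Def B Dbar DBt u p) =
    2^-1 * (a p (w p) (Dbar u B p) + a p (u p) (Dbar w B p)).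
Proof.
move=> vu vw; have [tu tw] := (vu.1 p, vw.1 p).
have [_ /(_ _ vw p) e] := hDBt vu.
rewrite /Def (metricZr ha) ?(metricDr ha); auto with tangent.
by rewrite -e (metricC ha tu); auto with tangent.
Qed.

Let W := weingartenB_perp a N B Dbar.

(** One formula covers both cases of the definition. The coefficient [k] can stay anonymous: it
    cancels in the final pairing. *)
Let weingartenB_perpP p : exists k : R,
  W p = (if B p == 0 then 0 else 1) *: (- Dbar B N p) - k *: B p
  /\ a p (B p) (W p) = 0.
Proof.
rewrite /W /weingartenB_perp /weingarten; case: eqVneq => [B0|B0].
  by exists 0; rewrite !scale0r subr0; split=> //; rewrite (metric0r ha).
have BB := lt0r_neq0 (metric_gt0 ha (tB p) B0).
eexists; split; first by rewrite scale1r.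
rewrite (metricDr ha) ?(metricNr ha) ?(metricZr ha) ?(metricNl ha);
  auto with tangent.
by rewrite divfK// (metricC ha (tB p))// ?subrr; auto with tangent.
Qed.

Let metric_compat0 X Y Z k p : vfield S X -> vfield S Y -> vfield S Z ->
  (forall q, a q (Y q) (Z q) = k) ->
  a p (Y p) (Dbar X Z p) = - a p (Z p) (Dbar X Y p).
Proof.
move=> vX vY vZ YZ; have := metric_compat p vX vY vZ.
have -> : (fun q => a q (Y q) (Z q)) = fun=> k by apply/funext.
rewrite (derivation_cst _ (vX.1 p)) (metricC ha (tDbar p vX vY) (vZ.1 p)).
by move/esym/eqP; rewrite addrC addr_eq0 => /eqP.
Qed.

Let D_N_normal X p : vfield S X -> a p (N p) (Dbar X N p) = 0.
Proof. by move=> vX; have := metric_compat0 p vX vN vN aNN; lra. Qed.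

Let D_B_B X p : vfield S X -> a p (B p) (Dbar X B p) = - (c p * X p c).
Proof.
move=> vX; have tX := vX.1 p; have := metric_compat p vX vB vB.
have -> : (fun q => a q (B q) (B q)) = fun q => -1 * (c q * c q) + 1.
  by apply/funext => q; rewrite -expr2 c_sqr; ring.
have scc := smooth_atM (@sc p) (@sc p).
rewrite (derivation_lin _ tX scc (@smooth_at_cst _ _ _ S p 1)).
rewrite (derivation_cst _ tX) (derivationM tX (@sc p) (@sc p)).
by rewrite (metricC ha (tDbar p vX vB) (tB p)); lra.
Qed.

(** Integrability makes [u, v] orthogonal to N; moving the derivatives from u and v onto N turns
    this into self-adjointness of Abar. *)
Let shape_sym u v p : ftan_field F u -> ftan_field F v ->
  a p (v p) (Dbar u N p) = a p (u p) (Dbar v N p).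
Proof.
move=> Fu Fv; have [vu tu Nu] := leaf Fu; have [vv tv Nv] := leaf Fv.
have := (ftanP ha hN p _).1 (ftan_bracket p hDbar Fu Fv) => -[_].
rewrite (metricDr ha) ?(metricNr ha); auto with tangent.
by rewrite (metric_compat0 p vu vN vv Nv) (metric_compat0 p vv vN vu Nu); lra.
Qed.

Let dc p : R := (c p *: N p - B p) c.
Let P := tproj a N (Dbar (fun q => N q - (c q)^-1 *: B q) B).
Let Z := Dbar N N.
(** [U1'] and [U2'] repeat the bodies of [U1] and [U2] over the abstract [c], so that they become
    convertible to them once [c] is instantiated. *)
Let U1' p : tvec R M := - (2^-1 * c p ^- 2) *:
  (dc p *: B p - (2 * (c p)^-1) *: tproj a N (Def B Dbar DBt B) p - P p
   + c p *: Z p + (c p * b p (Z p)) *: B p - W p).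
Let U2' p : tvec R M := 2^-1 *: (P p - c p *: Z p - W p).
Let rhs u p : tvec R M :=
  - Dbar u N p - (c p ^- 2 * dc p) *: u p
  + (c p)^-1 *: tproj a N (Def B Dbar DBt u) p
  + a p (U1' p) (u p) *: B p + b p (u p) *: U2' p.

Let vNcB : vfield S (fun q => N q - (c q)^-1 *: B q).
Proof.
have -> : (fun q => N q - (c q)^-1 *: B q) =
    fun q => (-1 * (c q)^-1) *: B q + N q.
  by apply/funext => q; rewrite mulN1r scaleNr addrC.
apply: vfield_lin => // q; apply: smooth_atM; first exact: smooth_at_cst.
exact: scV.
Qed.

Let D_NcB p : Dbar (fun q => N q - (c q)^-1 *: B q) B p =
  Dbar N B p - (c p)^-1 *: Dbar B B p.
Proof.
have [cD _ _] := hDbar.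
have -> : (fun q => N q - (c q)^-1 *: B q) =
    fun q => 1 *: N q + (-1 * (c q)^-1) *: B q.
  by apply/funext => q; rewrite mulN1r scaleNr scale1r.
rewrite (connection_linl p cD (@smooth_cst _ _ _ S 1) _ vN vB vB).
  by rewrite scale1r mulN1r scaleNr.
by move=> q; apply: smooth_atM; [exact: smooth_at_cst|exact: scV].
Qed.

Create HintDb extend.
#[local] Hint Resolve extendableD extendableN extendableZ : extend.
#[local] Hint Resolve extendable_field vN vB vDbar vDBt vNcB vD : extend.

Let extD u p : vfield S u -> extendable S p (Def B Dbar DBt u p).
Proof. by move=> vu; rewrite /Def; auto 6 with extend. Qed.

Let extT X p : extendable S p (X p) -> extendable S p (tproj a N X p).
Proof. by move=> eX; rewrite /tproj; auto 6 with extend. Qed.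

Let extW p : extendable S p (W p).
Proof. by have [k [-> _]] := weingartenB_perpP p; auto 6 with extend. Qed.

#[local] Hint Resolve extD extT extW : extend.

(** All coefficients, including the quotient by <B, B> in [W], are frozen at [p]; what remains are
    values of smooth fields. *)
Let ext_rhs u p : vfield S u -> extendable S p (rhs u p).
Proof.
move=> vu; have eP : extendable S p (P p) by apply: extT; auto with extend.
have eZ : extendable S p (Z p) by rewrite /Z; auto with extend.
have eD : extendable S p (tproj a N (Def B Dbar DBt u) p) by auto with extend.
have eU : extendable S p (U2' p) by rewrite /U2'; auto 10 with extend.
by rewrite /rhs; auto 12 with extend.
Qed.

Let extendable_tangent p (x : tvec R M) : extendable S p x -> tangent S p x.
Proof. by case=> X vX <-; exact: vX.1. Qed.

Let metric_tproj X (w : tvec R M) p : tangent S p w -> a p (N p) w = 0 ->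
  tangent S p (X p) -> a p w (tproj a N X p) = a p w (X p).
Proof.
move=> tw Nw tX; rewrite /tproj.
rewrite (metricDr ha) ?(metricNr ha) ?(metricZr ha); auto with tangent.
by rewrite (metricC ha tw (tN p)) Nw mulr0 subr0.
Qed.

Let normal_tproj X p : tangent S p (X p) -> a p (N p) (tproj a N X p) = 0.
Proof.
move=> tX; rewrite /tproj.
rewrite (metricDr ha) ?(metricNr ha) ?(metricZr ha); auto with tangent.
by rewrite aNN mulr1 (metricC ha (tN p))// subrr.
Qed.

Let NB p : a p (N p) (B p) = 0.
Proof. by rewrite (metricC ha)// -bE. Qed.

Let tW p : tangent S p (W p). Proof. exact/extendable_tangent/extW. Qed.
Let tP p : tangent S p (P p).
Proof. by apply/extendable_tangent/extT; auto with extend. Qed.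
Let tZ p : tangent S p (Z p). Proof. exact: tDbar. Qed.
Let tDef u p : vfield S u -> tangent S p (Def B Dbar DBt u p).
Proof. by move=> vu; exact/extendable_tangent/extD. Qed.
Let tTD u p : vfield S u -> tangent S p (tproj a N (Def B Dbar DBt u) p).
Proof. by move=> vu; apply: extendable_tangent; auto with extend. Qed.
Let tU2 p : tangent S p (U2' p).
Proof. by rewrite /U2'; auto 10 with tangent. Qed.

#[local] Hint Resolve tW tP tZ tDef tTD tU2 : tangent.

Section Combinations.
Variables (p : M) (x v1 v2 v3 v4 v5 v6 : tvec R M) (k k1 k2 k3 k4 : R).
Hypothesis tx : tangent S p x.
Hypotheses (t1 : tangent S p v1) (t2 : tangent S p v2) (t3 : tangent S p v3).

(** The three expansions have the exact shapes of [U2'], [rhs] and [U1'], and keep the component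
    vectors opaque. *)
Lemma metric_lin3 :
  a p x (k *: (v1 - k1 *: v2 - v3)) =
    k * (a p x v1 - k1 * a p x v2 - a p x v3).
Proof.
by rewrite (metricZr ha) ?(metricDr ha) ?(metricNr ha) ?(metricZr ha);
  auto 10 with tangent.
Qed.

Hypotheses (t4 : tangent S p v4) (t5 : tangent S p v5) (t6 : tangent S p v6).

Lemma metric_lin5 :
  a p x (- v1 - k1 *: v2 + k2 *: v3 + k3 *: v4 + k4 *: v5) =
    - a p x v1 - k1 * a p x v2 + k2 * a p x v3 + k3 * a p x v4 + k4 * a p x v5.
Proof.
by rewrite !(metricDr ha) ?(metricNr ha) ?(metricZr ha); auto 10 with tangent.
Qed.

Lemma metric_lin6 :
  a p x (k *: (k1 *: v1 - k2 *: v2 - v3 + k3 *: v4 + k4 *: v5 - v6)) =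
    k * (k1 * a p x v1 - k2 * a p x v2 - a p x v3 + k3 * a p x v4
         + k4 * a p x v5 - a p x v6).
Proof.
by rewrite (metricZr ha) ?(metricDr ha) ?(metricNr ha) ?(metricZr ha);
  auto 12 with tangent.
Qed.

End Combinations.

Let normal_W p : a p (N p) (W p) = 0.
Proof.
have [k [-> _]] := weingartenB_perpP p.
rewrite (metricDr ha) ?(metricNr ha) ?(metricZr ha) ?(metricNr ha);
  auto with tangent.
by rewrite D_N_normal// NB; ring.
Qed.

Let normal_rhs u p : ftan_field F u -> a p (N p) (rhs u p) = 0.
Proof.
move=> Fu; have [vu tu Nu] := leaf Fu.
rewrite /rhs metric_lin5 ?metric_lin3; auto with tangent.
have NP : a p (N p) (P p) = 0.
  exact/normal_tproj/extendable_tangent/extendable_field/vDbar.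
rewrite (normal_tproj (tDef p vu)) NP NB Nu normal_W /Z !D_N_normal//.
by ring.
Qed.

Let metric_U1 u p : ftan_field F u ->
  a p (U1' p) (u p) = - (2^-1 * c p ^- 2) *
    (dc p * b p (u p)
     - (c p)^-1 * (a p (u p) (Dbar B B p) + a p (B p) (Dbar u B p))
     - (a p (u p) (Dbar N B p) - (c p)^-1 * a p (u p) (Dbar B B p))
     + c p * a p (u p) (Z p) + c p * a p (B p) (Z p) * b p (u p)
     - a p (u p) (W p)).
Proof.
move=> Fu; have [vu tu Nu] := leaf Fu; have c0 := lt0r_neq0 (c_gt0 p).
have tU1 : tangent S p (U1' p) by rewrite /U1'; auto 12 with tangent.
rewrite (metricC ha tU1)// /U1' metric_lin6; auto with tangent.
rewrite metric_tproj ?metric_Def; auto with tangent.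
rewrite /P metric_tproj//; last by rewrite D_NcB; auto with tangent.
rewrite D_NcB (metricDr ha) ?(metricNr ha) ?(metricZr ha); auto with tangent.
by rewrite (metricC ha (tu p) (tB p)) -(bE (tu p)) (bE (tZ p)); field.
Qed.

Let metric_rhs u w p : ftan_field F u -> ftan_field F w ->
  a p (w p) (rhs u p) =
    - a p (w p) (Dbar u N p) - c p ^- 2 * dc p * a p (w p) (u p)
    + (c p)^-1 * (2^-1 * (a p (w p) (Dbar u B p) + a p (u p) (Dbar w B p)))
    + a p (U1' p) (u p) * b p (w p)
    + b p (u p) * (2^-1 * (a p (w p) (Dbar N B p)
                           - (c p)^-1 * a p (w p) (Dbar B B p)
                           - c p * a p (w p) (Z p) - a p (w p) (W p))).
Proof.
move=> Fu Fw; have [vu tu Nu] := leaf Fu; have [vw tw Nw] := leaf Fw.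
rewrite /rhs metric_lin5 ?metric_lin3; auto with tangent.
rewrite metric_tproj ?metric_Def; auto with tangent.
rewrite /P metric_tproj//; last by rewrite D_NcB; auto with tangent.
rewrite D_NcB (metricDr ha) ?(metricNr ha) ?(metricZr ha); auto with tangent.
by rewrite (metricC ha (tw p) (tB p)) -(bE (tw p)).
Qed.

Let gnu_rhs u w p : ftan_field F u -> ftan_field F w ->
  G p (- c p *: D u V p) (w p) = G p (rhs u p) (w p).
Proof.
move=> Fu Fw; have [vu tu Nu] := leaf Fu; have [vw tw Nw] := leaf Fw.
have c0 := lt0r_neq0 (c_gt0 p).
have tr : tangent S p (rhs u p) by exact/extendable_tangent/ext_rhs.
(* The factor 2 is the one carried by Koszul's formula. *)
have -> : G p (- c p *: D u V p) (w p) = - (c p / 2) * (2 * G p (D u V p) (w p)).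
  rewrite !GE; auto with tangent.
  rewrite (oneformZ hb) ?(metricZl ha) ?(metricZr ha); auto with tangent.
  by field.
rewrite gnu_D_nu// !D_nu_l// !D_nu_r//.
rewrite (G_leaf tr (tw p) (Nw p)) normal_rhs// (bE tr) (metricC ha tr (tw p)).
rewrite !metric_rhs// metric_U1//.
have [k [WE WB]] := weingartenB_perpP p.
rewrite WB !D_N_normal// !D_B_B//.
(* Normal form for the final [field]: N-components of derivatives are rewritten as derivatives of N,
   and the symmetry of Abar then leaves only <w, Dbar_u N>, <B, Dbar_x N> and pairings with [Z]. *)
rewrite (metric_compat0 p vu vN vB NB) (metric_compat0 p vw vN vB NB).
rewrite (metric_compat0 p vN vN vu Nu) (metric_compat0 p vN vN vw Nw).
rewrite (metric_compat0 p vB vN vu Nu) (metric_compat0 p vB vN vw Nw).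
rewrite (shape_sym p Fw Fu) !(shape_sym p Bleaf) //.
(* Thus V(c) = c^-2 (cN - B)(c), which is the origin of the multiple of the identity in the
   formula. *)
have VE : V p c = (c p)^-1 * N p c - c p ^- 2 * B p c.
  by rewrite nuE' /= !fctE /GRing.scale /=; field.
have dcE : dc p = c p * N p c - B p c by [].
have BB : a p (B p) (B p) = 1 - c p ^+ 2 by rewrite c_sqr; ring.
have xN x : ftan_field F x -> a p (x p) (N p) = 0.
  by case/leaf => _ tx Nx; rewrite (metricC ha (tx p)).
have xB x : ftan_field F x -> a p (x p) (B p) = b p (x p).
  by case/leaf => _ tx _; rewrite (metricC ha (tx p))// bE.
rewrite VE dcE !(xN _ Fu) !(xN _ Fw) !(xN _ Bleaf) !(xB _ Fu) !(xB _ Fw).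
rewrite -(bE (tu p)) (bE (tB p)) BB aNN NB (metricC ha (tw p) (tu p)) -/(Z p).
have [B0|B0] := eqVneq (B p) 0.
  have b0 x : tangent S p x -> b p x = 0.
    by move=> tx; rewrite bE// B0 (metric0l ha).
  by rewrite !b0//; field.
(* As W is orthogonal to B, it enters only through <u, W> beta(w) - beta(u) <w, W>, where the
   contributions of [k] cancel. *)
have WEx x : ftan_field F x -> a p (x p) (W p) =
    - a p (B p) (Dbar x N p) - k * b p (x p).
  move=> Fx; have [vx tx _] := leaf Fx.
  rewrite WE (negPf B0) scale1r.
  rewrite (metricDr ha) ?(metricNr ha) ?(metricZr ha); auto with tangent.
  by rewrite (shape_sym p Bleaf Fx) xB.
by rewrite !WEx//; field.
Qed.

Lemma shape_operator_nu u p : ftan_field F u ->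
  c p *: - D u V p =
    - Dbar u N p - (c p ^- 2 * dc p) *: u p
    + (c p)^-1 *: tproj a N (Def B Dbar DBt u) p
    + a p (U1' p) (u p) *: B p + b p (u p) *: U2' p.
Proof.
move=> Fu; have vu := Fu.1; rewrite -/(rhs u p).
pose x := - c p *: D u V p - rhs u p.
have tr : tangent S p (rhs u p) by exact/extendable_tangent/ext_rhs.
have ex : extendable S p x.
  by rewrite /x; apply: extendableD; [|apply: extendableN; exact: ext_rhs];
    auto with extend.
have tx := extendable_tangent ex.
have Nx : a p (N p) x = 0.
  rewrite (metricDr ha) ?(metricNr ha) ?(metricZr ha); auto with tangent.
  by rewrite D_nu_tangent// normal_rhs//; ring.
(* [gnu_rhs] is tested against leaf fields, but [x] is a vector at [p] only. Projecting an extension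
   of [x] gives such a field, and its value at [p] is still [x] because [x] is orthogonal to N. *)
have [X vX Xp] := ex.
have Fw := ftan_field_tproj ha hN vX.
have wp : tproj a N X p = x.
  by rewrite /tproj Xp (metricC ha)// Nx scale0r subr0.
have Gx : G p x x = 0.
  have := gnu_rhs p Fu Fw; rewrite wp => e.
  rewrite GDl ?e; auto with tangent.
  have -> : G p (- rhs u p) x = - G p (rhs u p) x.
    rewrite !GE; auto with tangent.
    by rewrite (oneformN hb)// !(metricNl ha, metricNr ha)//; ring.
  by rewrite subrr.
have : x = 0.
  apply/eqP; apply: contraT => x0; have xx := metric_gt0 ha tx x0.
  (* [Gx] amounts to <x, x> = beta(x)^2, whereas Cauchy-Schwarz gives beta(x)^2 <= (1 - c^2) <x, x>,
     which is strictly less than <x, x>. *)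
  have := metric_cauchy_schwarz ha (tB p) tx.
  have c2 : 0 < c p ^+ 2 by rewrite exprn_gt0.
  have : a p (B p) (B p) = 1 - c p ^+ 2 by rewrite c_sqr; ring.
  move=> ->; move: Gx; rewrite G_leaf// Nx bE// mulr0 mul0r addr0 => /eqP.
  rewrite mulf_eq0 (gt_eqF c2) /= -expr2 subr_eq0 => /eqP <-.
  have := mulr_gt0 c2 xx; lra.
rewrite /x => /eqP; rewrite subr_eq0 => /eqP <-.
by rewrite scalerN scaleNr.
Qed.

End ShapeOperator.

Theorem proposition3 (R : realType) (m : nat) (M : topologicalType)
  (S : smooth_manifold R m M)
  (a : form2 R M) (beta : M -> tvec R M -> R)
  (F : foliation1 S)
  (N B : M -> tvec R M)
  (Dbar D : (M -> tvec R M) -> (M -> tvec R M) -> M -> tvec R M)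
  (DBt : (M -> tvec R M) -> M -> tvec R M)
  (ha : riemannian S a)
  (hbeta : one_form S beta)
  (hnorm : forall p, form_norm S a beta p < 1)
  (hN : unit_normal a F N)
  (hbetaN : forall p, beta p (N p) = 0)
  (hB : sharp S a beta B)
  (hDbar : levi_civita S a Dbar)
  (hDBt : adjoint S a (fun v => Dbar v B) DBt)
  (hD : levi_civita S (gnu S a beta N B) D)
  (u : M -> tvec R M) (hu : ftan_field F u) (p : M) :
  let c := cR S a beta in
  c p *: weingarten D (nu S a beta N B) u p
  = weingarten Dbar N u p
    - (c p ^- 2 * dcR S a beta N B p) *: u p
    + (c p)^-1 *: tproj a N (Def B Dbar DBt u) p
    + a p (U1 S a beta N B Dbar DBt p) (u p) *: B p
    + beta p (u p) *: U2 S a beta N B Dbar p.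
Proof.
have [vN aNN _] := hN.
exact: (shape_operator_nu ha hbeta hN hbetaN hB hDbar
  (cR_gt0 ha hbeta vN aNN hbetaN hB hnorm)
  (cR_smooth ha hbeta vN aNN hbetaN hB hnorm)
  (cR_sqr ha hbeta vN aNN hbetaN hB hnorm)
  (nu_vfield ha hbeta vN aNN hbetaN hB hnorm)
  (nuE ha hbeta vN aNN hbetaN hB hnorm)
  (gnuE ha hbeta vN aNN hbetaN hB hnorm)
  (gnu_nu ha hbeta vN aNN hbetaN hB hnorm) hD hDBt p hu).
Qed.
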